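(* Let $\Bbbk$ be a field with $\operatorname{char}(\Bbbk)=0$, and let $m\geq 3$ and $n\geq 1$ be integers. The algebra $A(T_{m,n})$ over $\Bbbk$ has the weak Lefschetz property if and only if one of the following conditions holds: (i) $m\in\{3,6,10\}$ and $n\in\{1,3,4,7\}$; (ii) $m=4$ and $n\in\{1,2,3,4,5,6,7,9,10,13\}$; (iii) $m\in\{5,8\}$ and $n\in\{1,2,3,5,6,9\}$; (iv) $m=7$ and $n\in\{1,2,3,4,7\}$; (v) $(m,n)\in\{(9,1),(9,4),(11,2),(11,3),(11,6),(12,1),(13,1),(13,4),(14,3),(16,1)\}$.
   Context: Graphs are finite and simple. For integers $m\geq 3$ and $n\geq 1$, the tadpole graph $T_{m,n}$ is obtained from the disjoint union of the cycle $C_m$ with vertices $x_1,\ldots,x_m$ (edges $\{x_i,x_{i+1}\}$ for $1\le i<m$, and $\{x_m,x_1\}$) and the path $P_n$ with vertices $y_1,\ldots,y_n$ (edges $\{y_j,y_{j+1}\}$ for $1\le j<n$) by adding the edge $\{x_m,y_1\}$. For a graph $G$ with vertex set $\{1,\ldots,N\}$ and edge set $E$, let $R=\Bbbk[x_1,\ldots,x_N]$ be the standard graded polynomial ring and $I(G)=(x_ix_j \mid \{i,j\}\in E)$ the edge ideal. The Artinian algebra associated to $G$ is $A(G)=R/\bigl((x_1^2,\ldots,x_N^2)+I(G)\bigr)$. A standard graded Artinian $\Bbbk$-algebra $A=\bigoplus_{i=0}^{D}[A]_i$ has the weak Lefschetz property (WLP) if there exists a linear form $\ell\in[A]_1$ such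 that for every $i$ the multiplication map $\times\ell:[A]_i\to[A]_{i+1}$ is injective or surjective. *)

(* Defs.v *)
From HB Require Import structures.
From mathcomp Require Import all_boot all_order all_algebra.
From mathcomp Require Import boolp classical_sets functions.
From mathcomp Require Import mpoly ring_quotient.

Set Implicit Arguments.
Unset Strict Implicit.
Unset Printing Implicit Defensive.

Import GRing.Theory.
Local Open Scope ring_scope.
Local Open Scope quotient_scope.
Local Open Scope classical_set_scope.

Record sgraph (N : nat) := SGraph {
  adj :> rel 'I_N;
  adj_sym : ssrbool.symmetric adj;
  adj_irr : irreflexive adj
}.

Section GraphOfEdgeList.
Variables (N : nat) (e : rel 'I_N).

Definition edge_adj : rel 'I_N := fun u v => (u != v) && (e u v || e v u).

Lemma edge_adj_sym : ssrbool.symmetric edge_adj.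
Proof. by move=> u v; rewrite /edge_adj eq_sym orbC. Qed.

Lemma edge_adj_irr : irreflexive edge_adj.
Proof. by move=> u; rewrite /edge_adj eqxx. Qed.

Definition graph_of_edges : sgraph N := SGraph edge_adj_sym edge_adj_irr.

End GraphOfEdgeList.

(* The vertices of T_{m,n} are 'I_(m + n), decomposed by split: inl i is
   x_(i+1) and inr j is y_(j+1); every edge is listed in one direction. *)
Definition tadpole_edge (m n : nat) : rel 'I_(m + n) := fun u v =>
  match fintype.split u, fintype.split v with
  | inl i, inl i' => (i' == i.+1 :> nat) || (i.+1 == m) && (i' == 0%N :> nat)
  | inr j, inr j' => j' == j.+1 :> nat
  | inl i, inr j => (i.+1 == m) && (j == 0%N :> nat)
  | inr _, inl _ => false
  end.

Definition tadpole (m n : nat) : sgraph (m + n) :=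
  graph_of_edges (@tadpole_edge m n).

Definition ideal_gen (R : comNzRingType) (S : set R) : set R :=
  [set f | exists s : seq (R * R),
     (forall p, p \in s -> S p.2) /\ f = \sum_(p <- s) p.1 * p.2].

Section IdealGenTheory.
Variables (R : comNzRingType) (S : set R).

Lemma ideal_gen0 : ideal_gen S 0.
Proof. by exists [::]; split=> //; rewrite big_nil. Qed.

Lemma ideal_genD f g : ideal_gen S f -> ideal_gen S g -> ideal_gen S (f + g).
Proof.
move=> [s [sS ->]] [t [tS ->]]; exists (s ++ t); split; last by rewrite big_cat.
by move=> p; rewrite mem_cat => /orP[/sS|/tS].
Qed.

Lemma ideal_genM a f : ideal_gen S f -> ideal_gen S (a * f).
Proof.
move=> [s [sS ->]]; exists [seq (a * p.1, p.2) | p <- s]; split.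
  by move=> _ /mapP[p ps ->] /=; apply: sS.
by rewrite big_map mulr_sumr; apply: eq_bigr => p _; rewrite mulrA.
Qed.

End IdealGenTheory.

Section GraphAlgebra.
Variables (K : fieldType) (N : nat) (G : sgraph N).

Definition squares_ideal : set {mpoly K[N]} :=
  ideal_gen [set f | exists i : 'I_N, f = 'X_i ^+ 2].

Definition edge_ideal : set {mpoly K[N]} :=
  ideal_gen [set f | exists i j : 'I_N, G i j /\ f = 'X_i * 'X_j].

Definition defining_ideal : set {mpoly K[N]} :=
  [set h | exists f g, [/\ squares_ideal f, edge_ideal g & h = f + g]].

Definition defining_idealb : pred {mpoly K[N]} :=
  fun h => `[< defining_ideal h >].

Lemma defining_ideal_coef0 h : defining_ideal h -> h.@[fun=> 0] = 0.
Proof.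
have ev S : (forall f : {mpoly K[N]}, S f -> f.@[fun=> 0] = 0) ->
    forall f, ideal_gen S f -> f.@[fun=> 0] = 0.
  move=> S0 _ [s [sS ->]]; rewrite raddf_sum big_seq big1 // => p /sS /S0 /= p0.
  by rewrite mevalM p0 mulr0.
move=> [f [g [If Ig ->]]]; rewrite mevalD (ev _ _ _ If) ?(ev _ _ _ Ig) ?addr0 //.
- by move=> _ [i [j [_ ->]]]; rewrite mevalM mevalXU mul0r.
- by move=> _ [i ->]; rewrite expr2 mevalM mevalXU mul0r.
Qed.

Lemma defining_idealb_closed : idealr_closed defining_idealb.
Proof.
split.
- apply/asboolP; exists 0, 0; split; rewrite ?addr0 //; exact: ideal_gen0.
- apply/negP => /asboolP /defining_ideal_coef0 /eqP.
  by rewrite meval1 oner_eq0.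
move=> a u v /asboolP[f [g [If Ig ->]]] /asboolP[f' [g' [If' Ig' ->]]].
apply/asboolP; exists (a * f + f'), (a * g + g'); split.
- by apply: ideal_genD => //; apply: ideal_genM.
- by apply: ideal_genD => //; apply: ideal_genM.
- by rewrite mulrDr addrACA.
Qed.

HB.instance Definition _ :=
  isIdealr.Build {mpoly K[N]} defining_idealb defining_idealb_closed.

Definition defining_idealr : idealr {mpoly K[N]} := defining_idealb.

Definition graph_algebra : comNzRingType := {ideal_quot defining_idealr}.

Definition graph_algebra_pi (f : {mpoly K[N]}) : graph_algebra :=
  \pi_({ideal_quot defining_idealr}) f.

(* The defining ideal is homogeneous, so the degree d part of the quotient is
   the image of the polynomials of degree d. *)
Definition graph_algebra_part (d : nat) : set graph_algebra :=
  [set graph_algebra_pi f | f in [set f | f \is d.-homog]].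

End GraphAlgebra.

Arguments graph_algebra_part K {N} G d _.

Definition weak_lefschetz (A : comNzRingType) (part : nat -> set A) : Prop :=
  exists2 l : A, part 1%N l &
    forall i : nat, set_inj (part i) ( *%R l) \/
      set_surj (part i) (part i.+1) ( *%R l).

(* Main.v *)
From Stdlib Require Import BinNat BinInt FMapPositive.
Require Import Defs.
From HB Require Import structures.
From mathcomp Require Import all_boot all_order all_algebra.
From mathcomp Require Import zify ssrZ ring.
From mathcomp Require boolp classical_sets functions mpoly ring_quotient.
Import GRing.Theory.

Set Implicit Arguments.
Unset Strict Implicit.
Unset Printing Implicit Defensive.

(** The independent sets of size [i] form a monomial basis of the degree [i]
    part of the algebra, and in characteristic 0 the weak Lefschetz property
    can be tested on the sum of all variables.

    Let N = m + n.  If the vertices split into two halves without independent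
    sets of more than k vertices, then the sum over the independent k-sets S
    of (-1)^b a! b! x_S, where a and b are the numbers of elements of S in the
    two halves, is killed by the sum of the variables.  If there are k + 1
    pairwise non-adjacent pairs (p_j, q_j), then the product of the differences
    x_(p_j) - x_(q_j) is killed by the transposed map, so that multiplication
    is not surjective from degree k to degree k + 1.  Two halves of about 2k
    path vertices give the first obstruction for N <= 4k, and pairs of
    consecutive vertices the second one for 3(k + 1) <= N; together they
    exclude all N >= 18.  Slight refinements of both exclude exactly the
    required cases for N <= 17, and in the 49 remaining cases the maximal rank
    of the integer matrices is verified by sparse elimination. *)

Local Open Scope ring_scope.

(** * Multiplication by a linear form as a weighted incidence matrix *)

(** In characteristic 0 the numbers 0, ..., [size p] - 1 are distinct, and a non-zero [p] has fewer
    than [size p] roots. *)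
Lemma pchar0_nonroot (K : fieldType) (p : {poly K}) :
  [pchar K] =i pred0 -> p != 0 -> exists t, p.[t] != 0.
Proof.
move=> K0 p0; have natK := (pcharf0P K).1 K0.
pose rs : seq K := [seq i%:R | i <- iota 0 (size p)].
have rsU : uniq rs.
  rewrite map_inj_uniq ?iota_uniq // => i j; wlog le_ij: i j / (i <= j)%N.
    by move=> W; have /orP[/W//|/W H /esym/H] := leq_total i j.
  move/eqP; rewrite -(subnK le_ij) natrD -subr_eq0 opprD addrCA subrr addr0.
  by rewrite oppr_eq0 natK subn_eq0 => le_ji; rewrite subnK //; apply/eqP; rewrite eqn_leq le_ij.
have /allPn[t _ pt] : ~~ all (root p) rs.
  by apply/negP => /(max_poly_roots p0)/(_ rsU); rewrite size_map size_iota ltnn.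
by exists t.
Qed.

(** * Matrices indexed by finite sets *)

Section RowsFree.
Variables (K : fieldType) (X Y : finType).
Implicit Types (A : {set X}) (B : {set Y}) (a b : X -> Y -> K).

(* For the matrix of multiplication this says that multiplication is injective;
   for its transpose, that multiplication is surjective ([rows_free_surj]). *)
Definition rows_free A B a :=
  forall f : X -> K, (forall y, y \in B -> \sum_(x in A) f x * a x y = 0) ->
  forall x, x \in A -> f x = 0.

Definition mx_on A B a : 'M[K]_(#|A|, #|B|) :=
  \matrix_(i, j) a (enum_val i) (enum_val j).

Lemma mx_onE A B a (f : X -> K) (u : 'rV_#|A|) (j : 'I_#|B|) :
  (forall i, u 0 i = f (enum_val i)) ->
  (u *m mx_on A B a) 0 j = \sum_(x in A) f x * a x (enum_val j).
Proof.
move=> uE; rewrite mxE [RHS]big_enum_val; apply: eq_bigr => i _.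
by rewrite mxE uE.
Qed.

Definition fun_of_row A (u : 'rV[K]_#|A|) (x : X) : K :=
  if [pick i | enum_val i == x] is Some i then u 0 i else 0.

Lemma fun_of_rowE A (u : 'rV[K]_#|A|) i : u 0 i = fun_of_row u (enum_val i).
Proof.
rewrite /fun_of_row; case: pickP => [j /eqP/enum_val_inj->//|/(_ i)].
by rewrite eqxx.
Qed.

Lemma rows_freeP A B a : rows_free A B a <-> row_free (mx_on A B a).
Proof.
split=> [fr|/row_freeP[N MN] f f0 x Ax].
- rewrite -kermx_eq0; apply/eqP/row_matrixP => i; rewrite row0.
  set u := row i _; have uM : u *m mx_on A B a = 0.
    by apply/sub_kermxP; apply: row_sub.
  apply/rowP => k; rewrite fun_of_rowE mxE; apply: fr (enum_valP k) => y By.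
  rewrite -(enum_rankK_in By By) -(@mx_onE _ _ a _ u _ (fun_of_rowE u)).
  by rewrite uM mxE.
- pose u : 'rV_#|A| := \row_i f (enum_val i).
  have uE i : u 0 i = f (enum_val i) by rewrite mxE.
  have uM : u *m mx_on A B a = 0.
    by apply/rowP => j; rewrite (@mx_onE _ _ a _ u _ uE) mxE f0 // enum_valP.
  by rewrite -(enum_rankK_in Ax Ax) -uE -[u]mulmx1 -MN mulmxA uM mul0mx mxE.
Qed.

(** Both sides are changed by invertible diagonal matrices: if [f] is killed by [a], then
    [f x / r x] is killed by [b]. *)
Lemma rows_free_scale A B a b (r : X -> K) (s : Y -> K) :
  (forall x, x \in A -> r x != 0) -> (forall y, y \in B -> s y != 0) ->
  (forall x y, x \in A -> y \in B -> b x y = r x * a x y * s y) ->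
  rows_free A B b -> rows_free A B a.
Proof.
move=> r0 s0 bE fr f f0 x Ax.
have /eqP : f x / r x = 0.
  apply: (fr (fun x => f x / r x)) => // y By.
  transitivity ((\sum_(x in A) f x * a x y) * s y); last by rewrite f0 ?mul0r.
  rewrite mulr_suml; apply: eq_bigr => z Az.
  by rewrite bE // !mulrA divfK ?r0.
by rewrite mulf_eq0 invr_eq0 (negPf (r0 _ Ax)) orbF => /eqP.
Qed.

(* A right inverse N of M turns the minors of M + tL into the single polynomial
   det(1 + tLN), whose value at 0 is 1. *)
Lemma rows_free_pencil A B a b :
  rows_free A B a ->
  exists2 d : {poly K}, d != 0 &
    forall t, d.[t] != 0 -> rows_free A B (fun x y => a x y + t * b x y).
Proof.
move=> /rows_freeP/row_freeP[N MN]; pose L := mx_on A B b *m N.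
pose d := \det (1%:M + 'X *: map_mx polyC L).
have dE t : d.[t] = \det (1%:M + t *: L).
  rewrite -horner_evalE -det_map_mx; congr (\det _); apply/matrixP => i j.
  by rewrite !mxE /= horner_evalE !hornerE; case: (i == j); rewrite ?hornerE.
exists d => [|t].
  apply/negP => /eqP d0; have := dE 0; rewrite d0 horner0 scale0r addr0 det1.
  by move/eqP; rewrite eq_sym oner_eq0.
rewrite dE -unitfE -[_ \is a _]/(_ \in unitmx) => U; apply/rows_freeP/row_freeP.
exists (N *m invmx (1%:M + t *: L)); rewrite mulmxA.
have -> : mx_on A B (fun x y => a x y + t * b x y) = mx_on A B a + t *: mx_on A B b.
  by apply/matrixP => i j; rewrite !mxE.
by rewrite mulmxDl MN -scalemxAl mulmxV.
Qed.

End RowsFree.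

(** Row rank equals column rank, so independent rows of the transpose mean that every linear system
    for the matrix is solvable. *)
Lemma rows_free_surj (K : fieldType) (X Y : finType) (A : {set X}) (B : {set Y})
    (a : X -> Y -> K) :
  rows_free B A (fun y x => a x y) <->
  (forall g : Y -> K, exists f : X -> K,
     forall y, y \in B -> \sum_(x in A) f x * a x y = g y).
Proof.
have rkE : row_free (mx_on B A (fun y x => a x y)) = row_full (mx_on A B a).
  by rewrite /row_full -mxrank_tr; congr (\rank _ == _); apply/matrixP=> i j; rewrite !mxE.
split=> [/rows_freeP|sj]; last apply/rows_freeP; rewrite rkE.
- move=> /row_fullP[N NM] g.
  pose u : 'rV_#|B| := \row_j g (enum_val j).
  exists (fun_of_row (u *m N)) => y By; rewrite -(enum_rankK_in By By).
  rewrite -(@mx_onE _ _ _ _ _ a _ (u *m N) _ (fun_of_rowE (u *m N))).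
  by rewrite -mulmxA NM mulmx1 mxE.
- rewrite -sub1mx; apply/row_subP => i.
  have [f fE] := sj (fun y => (y == enum_val i)%:R).
  apply/submxP; exists (\row_k f (enum_val k)); apply/rowP => j.
  rewrite (@mx_onE _ _ _ _ _ a f) => [|k]; last by rewrite mxE.
  by rewrite fE ?enum_valP // !mxE (inj_eq enum_val_inj) eq_sym.
Qed.

(** * Independent sets and their weighted incidences *)

Section Stable.
Variables (K : fieldType) (N : nat).
Implicit Types (e : rel 'I_N) (S T : {set 'I_N}) (w z : 'I_N -> K).

Definition stable e S := [forall u in S, forall v in S, ~~ e u v].

Definition stables e k := [set S | stable e S & #|S| == k].

(** This is the coefficient of x_T in (sum of w_v x_v) x_S; the sum has at most one term, the weight
    of the vertex that is added to [S]. *)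
Definition incidence w S T : K := \sum_(v in T | T :\ v == S) w v.

Lemma stableP e S :
  reflect {in S &, forall u v, ~~ e u v} (stable e S).
Proof.
apply: (iffP forall_inP) => [H u v /H/forall_inP Hu /Hu//|H u Su].
by apply/forall_inP => v; apply: H.
Qed.

Lemma stableS e S T : S \subset T -> stable e T -> stable e S.
Proof. by move=> /subsetP ST /stableP H; apply/stableP => u v /ST Tu /ST; apply: H. Qed.

Lemma incidenceD w z t S T :
  incidence (fun v => w v + t * z v) S T = incidence w S T + t * incidence z S T.
Proof. by rewrite /incidence big_split mulr_sumr. Qed.

(** If [T] is [S] with [v] added, the two products differ by the factor [w v]; this is the
    substitution of w_v x_v for x_v. *)
Lemma incidence_scale w S T : (forall v, w v != 0) ->
  incidence w S T =
  (\prod_(v in S) w v)^-1 * incidence (fun=> 1) S T * \prod_(v in T) w v.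
Proof.
move=> w0; rewrite /incidence mulr_sumr mulr_suml; apply: eq_bigr => v /andP[Tv /eqP <-].
rewrite mulr1 (big_setD1 v Tv) /= mulrCA mulVf ?mulr1 //.
by apply/prodf_neq0.
Qed.

(* Replacing the zero weights by a generic t preserves the ranks, and rescaling
   the variables turns non-zero weights into 1. *)
Lemma generic_weights e w i j : [pchar K] =i pred0 ->
  (rows_free (stables e i) (stables e j) (incidence w) ->
   rows_free (stables e i) (stables e j) (incidence (fun=> 1))) /\
  (rows_free (stables e i) (stables e j) (fun T S => incidence w S T) ->
   rows_free (stables e i) (stables e j) (fun T S => incidence (fun=> 1) S T)).
Proof.
move=> K0; pose z v : K := (w v == 0)%:R; pose wt t v := w v + t * z v.
have wt0 t : t != 0 -> forall v, wt t v != 0.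
  move=> t0 v; rewrite /wt /z; have [->|wv] := eqVneq (w v) 0.
    by rewrite add0r mulr1.
  by rewrite mulr0 addr0.
have P0 t : t != 0 -> forall S, \prod_(v in S) wt t v != 0.
  by move=> t0 S; apply/prodf_neq0 => v _; apply: wt0.
have nr (d : {poly K}) : d != 0 -> exists2 t, t != 0 & d.[t] != 0.
  (* The factor ['X] forces the non-root [t] to be non-zero. *)
  move=> d0; have [|t] := @pchar0_nonroot _ (d * 'X) K0.
    by rewrite mulf_neq0 ?polyX_eq0.
  by rewrite hornerM hornerX mulf_eq0 negb_or => /andP[dt t0]; exists t.
split=> /rows_free_pencil pencil.
- have [d /nr[t t0 dt] /(_ t dt)] := pencil (incidence z).
  apply: rows_free_scale (fun S _ => invr_neq0 (P0 t t0 S)) (fun T _ => P0 t t0 T) _.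
  by move=> S T _ _; rewrite -incidenceD -incidence_scale //; apply: wt0.
- have [d /nr[t t0 dt] /(_ t dt)] := pencil (fun T S => incidence z S T).
  apply: rows_free_scale (fun T _ => P0 t t0 T) (fun S _ => invr_neq0 (P0 t t0 S)) _.
  move=> T S _ _; rewrite -incidenceD incidence_scale; last exact: wt0.
  by rewrite [RHS]mulrAC mulrC mulrA.
Qed.

Lemma stablesS1 e i T v : T \in stables e i.+1 -> v \in T -> T :\ v \in stables e i.
Proof.
rewrite !inE => /andP[sT /eqP cT] Tv; rewrite (stableS (subsetDl _ _) sT) /=.
by move: cT; rewrite (cardsD1 v) Tv add1n => -[->].
Qed.

Lemma sum_incidence e w i (f : {set 'I_N} -> K) T : T \in stables e i.+1 ->
  \sum_(S in stables e i) f S * incidence w S T = \sum_(v in T) w v * f (T :\ v).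
Proof.
move=> sT; under eq_bigr do rewrite mulr_sumr big_mkcondr.
rewrite exchange_big; apply: eq_bigr => v Tv /=; rewrite -big_mkcondr /=.
rewrite (big_pred1 (T :\ v)) 1?mulrC // => S /=.
by rewrite eq_sym; case: eqP => [->|]; rewrite ?andbF ?andbT ?stablesS1.
Qed.

Lemma sum_incidence_tr e w i (g : {set 'I_N} -> K) S : S \in stables e i ->
  \sum_(T in stables e i.+1) g T * incidence w S T =
  \sum_(v | (v \notin S) && stable e (v |: S)) w v * g (v |: S).
Proof.
rewrite inE => /andP[_ /eqP cS]; under eq_bigr do rewrite mulr_sumr big_mkcond.
rewrite exchange_big [RHS]big_mkcond; apply: eq_bigr => v _ /=; rewrite -big_mkcondr /=.
have SvE T : (v \in T) && (T :\ v == S) = (v \notin S) && (T == v |: S).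
  apply/andP/andP => [[Tv /eqP <-]|[Sv /eqP ->]].
    by rewrite !inE eqxx setD1K.
  by rewrite setU11 setU1K.
under eq_bigl do rewrite SvE inE.
case: ifP => [/andP[Sv sv]|H].
  rewrite (big_pred1 (v |: S)) 1?mulrC // => T /=; rewrite Sv.
  by case: (T =P v |: S) => [->|]; rewrite ?andbF // sv cardsU1 Sv cS eqxx.
rewrite big_pred0 // => T; case: (T =P v |: S) => [->|_]; rewrite ?andbF // andbT.
by apply: contraFF H => /andP[/andP[-> _] ->].
Qed.

End Stable.

(** * The algebra in its basis of independent sets *)

Section Model.
Import boolp classical_sets functions mpoly ring_quotient.
Variables (K : fieldType) (N : nat) (G : sgraph N).
Implicit Types (S T : {set 'I_N}) (w : 'I_N -> K) (f g h : {mpoly K[N]}).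

Definition mset S : 'X_{1..N} := [multinom (v \in S : nat) | v < N].

Lemma mset_inj : injective mset.
Proof.
move=> S T /mnmP ST; apply/setP => v; move: (ST v); rewrite !mnmE.
by case: (v \in S); case: (v \in T).
Qed.

Lemma mdeg_mset S : mdeg (mset S) = #|S|.
Proof.
rewrite mdegE -sum1_card [RHS]big_mkcond; apply: eq_bigr => v _; rewrite mnmE.
by case: (v \in S).
Qed.

Lemma msetD1 T v : v \in T -> mset T = (mset (T :\ v) + U_(v))%MM.
Proof.
move=> Tv; apply/mnmP => u; rewrite mnmDE mnm1E !mnmE !inE eq_sym.
by case: eqP => [<-|]; rewrite ?Tv // addn0.
Qed.

Lemma mcoeffMX_out f (m k : 'X_{1..N}) : ~~ (m <= k)%MM -> (f * 'X_[m])@_k = 0.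
Proof.
move=> mk; apply/memN_msupp_eq0; apply: contra mk.
rewrite (perm_mem (msuppMX _ _)) => /mapP[m' _ ->]; exact: lem_addr.
Qed.

Lemma ideal_gen_coef (A : set {mpoly K[N]}) k :
  (forall f, A f -> exists2 m, f = 'X_[m] & ~~ (m <= k)%MM) ->
  forall f, ideal_gen A f -> f@_k = 0.
Proof.
move=> AX _ [s [sA ->]]; rewrite raddf_sum big_seq big1 // => p /sA/AX[m -> mk].
exact: mcoeffMX_out.
Qed.

Lemma notin_le_mset S (m : 'X_{1..N}) i : (mset S i < m i)%N -> ~~ (m <= mset S)%MM.
Proof. by move=> lt; apply/mnm_lepP => /(_ i); rewrite leqNgt lt. Qed.

(** The ideal is spanned by monomials, and the monomials outside it are the squarefree ones with
    independent support. *)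
Lemma defining_idealP f :
  @defining_ideal K N G f <-> forall S, stable G S -> f@_(mset S) = 0.
Proof.
split=> [[g [h [Ig Ih ->]]] S sS|f0].
  rewrite mcoeffD (ideal_gen_coef _ Ig) ?(ideal_gen_coef _ Ih) ?addr0 //.
  - move=> _ [i [j [Gij ->]]]; exists (U_(i) + U_(j))%MM; first by rewrite mpolyXD.
    apply/negP => /mnm_lepP le; have ij : i != j.
      by apply/eqP => ij; rewrite ij adj_irr in Gij.
    have := le i; have := le j; rewrite !mnmDE !mnm1E !eqxx !mnmE.
    rewrite (eq_sym j) (negPf ij) addn0 add0n; case: (boolP (j \in S)) => // Sj _.
    by case: (boolP (i \in S)) => // Si _; move/stableP: sS => /(_ i j Si Sj); rewrite Gij.
  - move=> _ [i ->]; exists (U_(i) + U_(i))%MM; first by rewrite mpolyXD expr2.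
    apply: (@notin_le_mset _ _ i); rewrite mnmDE !mnm1E eqxx mnmE.
    by case: (i \in S).
apply/asboolP; rewrite -[_ (_ f)]/(f \in @defining_idealr K N G) [f]mpolyE.
rewrite big_seq; apply: rpred_sum => m mf; rewrite -mul_mpolyC; apply: idealMr.
have Igen i j : (U_(i) + U_(j) <= m)%MM -> @defining_ideal K N G ('X_i * 'X_j) ->
    'X_[m] \in @defining_idealr K N G.
  move=> /submK <- I; rewrite mpolyXD; apply: idealMr.
  by rewrite mpolyXD; apply/asboolP.
(* A monomial of [f] either has an exponent above 1, or is some x_S. In the latter case [S] contains
   an edge, or it is stable and the coefficient vanishes. *)
have [|nsq] := boolP [exists i, 1 < m i]%N.
  move=> /existsP[i mi]; apply: (Igen i i).
    apply/mnm_lepP => j; rewrite mnmDE mnm1E; case: eqP => [<-|] //.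
  exists ('X_i * 'X_i), 0; split; rewrite ?addr0 //; last exact: ideal_gen0.
  exists [:: (1, 'X_i ^+ 2)]; split=> [p|]; last by rewrite big_seq1 mul1r.
  by rewrite inE => /eqP -> /=; exists i.
pose S := [set v | m v == 1%N]; have mS : m = mset S.
  apply/mnmP => v; rewrite mnmE inE; move: nsq; rewrite negb_exists => /forallP/(_ v).
  by case: (m v) => [|[|]].
have [sS|] := boolP (stable G S).
  by move: mf; rewrite mcoeff_msupp mS f0 ?eqxx.
rewrite negb_forall_in => /exists_inP[i Si]; rewrite negb_forall_in.
move=> /exists_inP[j Sj]; rewrite negbK => Gij; apply: (Igen i j).
  apply/mnm_lepP => k; rewrite mnmDE !mnm1E.
  have ij : i != j by apply/eqP => ij; rewrite ij adj_irr in Gij.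
  move: Si Sj; rewrite !inE => /eqP mi /eqP mj.
  case: (eqVneq i k) => [<-|_]; first by rewrite mi eq_sym (negPf ij).
  by case: (eqVneq j k) => [<-|//]; rewrite mj.
exists 0, ('X_i * 'X_j); split; rewrite ?add0r //; first exact: ideal_gen0.
exists [:: (1, 'X_i * 'X_j)]; split=> [p|]; last by rewrite big_seq1 mul1r.
by rewrite inE => /eqP -> /=; exists i, j.
Qed.

Notation pi := (@graph_algebra_pi K N G).

Lemma pi_eqP f g : pi f = pi g <-> forall S, stable G S -> f@_(mset S) = g@_(mset S).
Proof.
have -> : (pi f = pi g) <-> @defining_ideal K N G (f - g).
  have E := Quotient.idealrBE (@defining_idealr K N G) f g.
  by split=> [fg|/asboolP fg]; [apply/asboolP; rewrite -[`[< _ >]]/(f - g \in @defining_idealr K N G) E; apply/eqP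
    | apply/eqP; rewrite -[_ == _]E].
rewrite defining_idealP; split=> H S /H; rewrite mcoeffB.
  by move/eqP; rewrite subr_eq0 => /eqP.
by move=> ->; rewrite subrr.
Qed.

Lemma piM f g : pi f * pi g = pi (f * g).
Proof. exact/esym/rmorphM. Qed.

Definition linear_form w : {mpoly K[N]} := \sum_v w v *: 'X_v.

Definition poly_on i (c : {set 'I_N} -> K) : {mpoly K[N]} :=
  \sum_(S in stables G i) c S *: 'X_[mset S].

Lemma linear_form_homog w : linear_form w \is 1.-homog.
Proof. by apply: rpred_sum => v _; apply/dhomogZ; rewrite dhomogX /= mdeg1. Qed.

Lemma poly_on_homog i c : poly_on i c \is i.-homog.
Proof.
apply: rpred_sum => S; rewrite inE => /andP[_ /eqP cS].
by apply/dhomogZ; rewrite dhomogX /= mdeg_mset cS.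
Qed.

Lemma poly_onE i c S : S \in stables G i -> (poly_on i c)@_(mset S) = c S.
Proof.
move=> iS; rewrite raddf_sum (bigD1 S) //= mcoeffZ mcoeffX eqxx mulr1 big1 ?addr0 //.
move=> T /andP[_ TS]; rewrite mcoeffZ mcoeffX; case: eqP => [/mset_inj/eqP|].
  by rewrite (negPf TS).
by rewrite mulr0.
Qed.

Lemma homog1E f : f \is 1.-homog -> f = linear_form (fun v => f@_U_(v)).
Proof.
move=> hf; apply/mpolyP => m; rewrite raddf_sum /=.
have [/eqP/mdeg1P[v /eqP ->]|m1] := eqVneq (mdeg m) 1%N.
  rewrite (bigD1 v) //= mcoeffZ mcoeffXU eqxx mulr1 big1 ?addr0 // => u uv.
  by rewrite mcoeffZ mcoeffXU (negPf uv) mulr0.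
rewrite (dhomog_nemf_coeff hf m1) big1 // => v _; rewrite mcoeffZ mcoeffX.
by case: (U_(v)%MM =P m) m1 => [<-|]; rewrite ?mdeg1 // mulr0.
Qed.

Lemma coef_linear_formM w g T :
  (linear_form w * g)@_(mset T) = \sum_(v in T) w v * g@_(mset (T :\ v)).
Proof.
rewrite mulr_suml raddf_sum [RHS]big_mkcond; apply: eq_bigr => v _ /=.
rewrite -scalerAl mcoeffZ (mulrC _ g); case: ifP => Tv.
  by rewrite {1}(msetD1 Tv) addmC mcoeffMX.
rewrite mcoeffMX_out ?mulr0 // (@notin_le_mset _ _ v) // mnm1E eqxx mnmE.
by rewrite Tv.
Qed.

Lemma homog_coef_eq f g i : f \is i.-homog -> g \is i.-homog ->
  (forall S, S \in stables G i -> f@_(mset S) = g@_(mset S)) -> pi f = pi g.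
Proof.
move=> hf hg fg; apply/pi_eqP => S sS; have [cS|cS] := eqVneq #|S| i.
  by apply: fg; rewrite inE sS cS eqxx.
rewrite (dhomog_nemf_coeff hf) ?(dhomog_nemf_coeff hg) //= mdeg_mset //.
Qed.

Lemma coef_mul_sum w g i T : T \in stables G i.+1 ->
  (linear_form w * g)@_(mset T) =
  \sum_(S in stables G i) g@_(mset S) * incidence w S T.
Proof. by move=> iT; rewrite coef_linear_formM (sum_incidence _ (fun S => g@_(mset S)) iT). Qed.

(** A linear form is a choice of weights, and by [pi_eqP] the classes of degree i correspond to
    functions on [stables G i]. Multiplication then has the matrix [incidence w], and surjectivity
    is read off its transpose. *)
Lemma weak_lefschetzE :
  weak_lefschetz (graph_algebra_part K G) <->
  exists w, forall i,
    rows_free (stables G i) (stables G i.+1) (incidence w) \/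
    rows_free (stables G i.+1) (stables G i) (fun T S => incidence w S T).
Proof.
have stS i S : S \in stables G i -> stable G S by rewrite inE => /andP[].
have hM w i g : g \is i.-homog -> linear_form w * g \is i.+1.-homog.
  by move=> hg; rewrite -add1n; apply: dhomogM => //; apply: linear_form_homog.
split=> [[_ [l /= hl <-] H]|[w H]].
  exists (fun v => l@_U_(v)) => i; move: (H i); rewrite {1 2}(homog1E hl).
  set w := fun v => _; case=> [inj|sj]; [left|right].
  - move=> c c0 S iS; have: pi (poly_on i c) = pi (poly_on i (fun=> 0)).
      apply: inj; rewrite ?inE; first by exists (poly_on i c) => //; apply: poly_on_homog.
        by exists (poly_on i (fun=> 0)) => //; apply: poly_on_homog.
      rewrite !piM; apply: (@homog_coef_eq _ _ i.+1); try exact/hM/poly_on_homog.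
      move=> T iT; rewrite !(coef_mul_sum _ _ iT).
      under eq_bigr => R iR do rewrite poly_onE //.
      under [RHS]eq_bigr => R iR do rewrite poly_onE // mul0r.
      by rewrite c0 // big1.
    by move/pi_eqP/(_ S (stS _ _ iS)); rewrite !poly_onE.
  - apply/rows_free_surj => c; have [|_ [g hg <-]] := sj (pi (poly_on i.+1 c)).
      by exists (poly_on i.+1 c) => //; apply: poly_on_homog.
    rewrite piM => /pi_eqP gE; exists (fun S => g@_(mset S)) => T iT.
    by rewrite -(coef_mul_sum _ _ iT) gE ?poly_onE //; apply: stS iT.
exists (pi (linear_form w)); first by exists (linear_form w) => //; apply: linear_form_homog.
move=> i; case: (H i) => [fr|/rows_free_surj sj]; [left|right].
- move=> x y; rewrite !inE => -[f hf <-] [g hg <-]; rewrite !piM => /pi_eqP fg.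
  apply: (homog_coef_eq hf hg) => S iS; apply/eqP; rewrite -subr_eq0 -mcoeffB.
  apply/eqP; apply: (fr (fun S => (f - g)@_(mset S))) => // T iT.
  by rewrite -(coef_mul_sum _ _ iT) mulrBr mcoeffB fg ?subrr //; apply: stS iT.
- move=> _ [h hh <-]; have [c cE] := sj (fun T => h@_(mset T)).
  exists (pi (poly_on i c)); first by exists (poly_on i c) => //; apply: poly_on_homog.
  rewrite piM; apply: (homog_coef_eq (hM _ _ _ (poly_on_homog _ _)) hh) => T iT.
  rewrite (coef_mul_sum _ _ iT) -cE //; apply: eq_bigr => S iS.
  by rewrite poly_onE.
Qed.

End Model.

(** * The two obstructions *)

Section Failure.
Variables (K : fieldType) (N : nat) (e : rel 'I_N).
Hypothesis K0 : [pchar K] =i pred0.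
Implicit Types S T B : {set 'I_N}.

Lemma kernel_of_halves k B :
  (forall T, T \in stables e k.+1 -> (0 < #|T :&: B|)%N && (0 < #|T :\: B|)%N) ->
  stables e k != set0 ->
  ~ rows_free (stables e k) (stables e k.+1) (incidence (fun=> 1 : K)).
Proof.
move=> hB /set0Pn[S kS] /(_ (fun S => (-1) ^+ #|S :&: B| * (#|S :&: B|`!)%:R * (#|S :\: B|`!)%:R)).
move=> fr; have/eqP : (-1) ^+ #|S :&: B| * (#|S :&: B|`!)%:R * (#|S :\: B|`!)%:R = 0 :> K.
  apply: fr (kS) => T kT; rewrite sum_incidence //; under eq_bigr do rewrite mul1r.
  (* Let [T] have b + 1 elements in [B] and a + 1 outside. Deleting one in [B] contributes (b + 1)
     (-1)^b b! (a + 1)! in total, deleting one outside (a + 1) (-1)^(b + 1) (b + 1)! a!, and these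
     cancel. *)
  have [] := andP (hB T kT); rewrite (big_setID B) /=.
  case Eb: #|T :&: B| => [//|b] _; case Ea: #|T :\: B| => [//|a] _.
  under eq_bigr => v vT.
    have [Tv Bv] := setIP vT.
    have -> : (T :\ v) :&: B = (T :&: B) :\ v by rewrite setIDAC.
    have -> : (T :\ v) :\: B = T :\: B.
      by apply/setP=> u; rewrite !inE; case: eqP => [->|]//; rewrite Bv.
    have -> : #|(T :&: B) :\ v| = b.
      by move: Eb; rewrite (cardsD1 v) vT add1n => -[].
    rewrite Ea.
  over.
  under [X in _ + X]eq_bigr => v vT.
    have /setDP[Tv Bv] := vT.
    have -> : (T :\ v) :\: B = (T :\: B) :\ v.
      by apply/setP=> u; rewrite !inE andbCA.
    have -> : (T :\ v) :&: B = T :&: B.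
      apply/setP=> u; rewrite !inE; case: eqP => [->|]//=.
      by rewrite (negPf Bv) andbF.
    have -> : #|(T :\: B) :\ v| = a.
      by move: Ea; rewrite (cardsD1 v) vT add1n => -[].
    rewrite Eb.
  over.
  rewrite !sumr_const Ea Eb !factS exprS -2!mulr_natr !natrM.
  move: ((-1) ^+ b) (b`!%:R) (a`!%:R) => x y z; ring.
by rewrite !mulf_eq0 signr_eq0 /= !((pcharf0P K).1 K0) !eqn0Ngt !fact_gt0.
Qed.

(* [c v] is the index of the pair containing v, and [s v] is 1, -1 or 0 according
   to whether v is its first element, its second element, or is not used. *)
Lemma cokernel_of_pairs (C : finType) (c : 'I_N -> C) (s : 'I_N -> K) d T0 :
  irreflexive e ->
  (forall u v, e u v -> s u * s v != 0 -> c u = c v) ->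
  (forall x, \sum_(v | c v == x) s v = 0) ->
  {in T0 &, injective c} -> {in T0, forall v, s v != 0} -> #|T0| = d.+1 ->
  ~ rows_free (stables e d.+1) (stables e d) (fun T S => incidence (fun=> 1 : K) S T).
Proof.
move=> eI ec sc cT0 sT0 dT0.
(* The coefficient of x_T in the product, over all classes of [c], of 1 plus the sum of s_v x_v over
   the class. *)
pose g T : K := \prod_(v in T) s v * (#|c @: T| == #|T|)%:R.
have gst T : g T != 0 -> stable e T.
  rewrite mulf_eq0 negb_or (pcharf0P K).1 // eqb0 negbK => /andP[/prodf_neq0 sT cT].
  apply/stableP => u v Tu Tv; apply/negP => euv.
  have cuv := ec _ _ euv (mulf_neq0 (sT _ Tu) (sT _ Tv)).
  by move: euv; rewrite ((imset_injP cT) _ _ Tu Tv cuv) eI.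
have gT0 : g T0 != 0.
  rewrite mulf_neq0 //; first exact/prodf_neq0.
  by rewrite card_in_imset // eqxx oner_eq0.
have T0d : T0 \in stables e d.+1 by rewrite inE gst //= dT0.
move=> /(_ g) fr; case/eqP: gT0; apply: fr (T0d) => S dS; rewrite sum_incidence_tr //; under eq_bigr do rewrite mul1r.
rewrite (eq_bigl [pred v | (v \notin S) && stable e (v |: S)]) //.
transitivity (\sum_(v | v \notin S) g (v |: S)).
  rewrite big_mkcondr /=; apply: eq_bigr => v _; case: ifP => // /negP st.
  by apply/esym/eqP; apply: contra_notT st; apply: gst.
(* A vertex from a class that [S] already meets contributes 0. The remaining vertices form whole
   classes, on each of which [s] sums to 0. *)
transitivity (\sum_(v | c v \notin c @: S) s v * g S).
  rewrite [LHS]big_mkcond [RHS]big_mkcond; apply: eq_bigr => v _.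
  have [vS|vS] /= := boolP (v \in S); first by rewrite imset_f.
  rewrite /g big_setU1 //= imsetU1 !cardsU1 vS; case: (boolP (c v \in _)) => cv /=.
    rewrite add0n add1n; case: eqP => [E|_]; last by rewrite mulr0.
    by have := leq_imset_card c (mem S); rewrite E ltnn.
  by rewrite !add1n eqSS mulrA.
rewrite -mulr_suml (partition_big c (fun x => x \notin c @: S)) //=.
rewrite big1 ?mul0r // => x xS; rewrite -[RHS](sc x); apply: eq_bigl => v.
by case: eqP => [->|]; rewrite ?xS ?andbF.
Qed.

End Failure.

(** Pigeonhole: two elements of [T] with the same colour [f] would be adjacent, so [f] is injective
    on [T]. *)
Lemma stable_card_le N (e : rel 'I_N) (T : {set 'I_N}) (f : nat -> nat) k :
  stable e T -> (forall v, v \in T -> (f v < k)%N) ->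
  (forall u v, u \in T -> v \in T -> u != v -> f u = f v -> e u v) -> (#|T| <= k)%N.
Proof.
move=> /stableP sT fk fe; rewrite -[k]card_ord.
have [->|/set0Pn[v0 Tv0]] := eqVneq T set0; first by rewrite cards0.
case: k fk (fk _ Tv0) => // k fk _; pose g (v : 'I_N) : 'I_k.+1 := inord (f v).
rewrite -(@card_in_imset _ _ g) ?max_card // => u v Tu Tv guv.
apply/eqP/negPn/negP => uv; apply/negP: (sT _ _ Tu Tv); rewrite negbK.
by apply: fe => //; move/(congr1 val): guv; rewrite /= !inordK ?fk.
Qed.

(** * The obstructions for tadpole graphs *)

Section Tadpole.
Variables (m n : nat).
Hypotheses (m3 : (3 <= m)%N) (n1 : (1 <= n)%N).

(** In this numbering the graph is the path 0, 1, ..., m + n - 1, whose edge from m - 1 to m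
    attaches the tail, together with one extra edge from 0 to m - 1. *)
Definition tadpole_adj (u v : nat) : bool :=
  [|| v == u.+1, u == v.+1, (u == 0%N) && (v == m.-1) | (v == 0%N) && (u == m.-1)].

Lemma tadpoleE (u v : 'I_(m + n)) : tadpole m n u v = tadpole_adj u v.
Proof.
rewrite /tadpole /= /edge_adj /tadpole_edge /tadpole_adj -(inj_eq val_inj) /=.
have [i ui|i ui] := fintype.splitP u; have [j vj|j vj] := fintype.splitP v; rewrite ?ui ?vj /=.
all: have := ltn_ord i; have := ltn_ord j; lia.
Qed.

Variables (K : fieldType) (K0 : [pchar K] =i pred0).
Local Notation N := (m + n)%N.
Local Notation e := (adj (tadpole m n)).

(* The second alternative exploits that an odd cycle of length m has no
   independent set with more than (m - 1) / 2 vertices. *)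
Definition kernel_degree k := (N <= 4 * k)%N || [&& N == (4 * k).+1, odd m & (m <= (2 * k).+1)%N].

(* The pairs are {3j + 1, 3j + 2}, which avoid the vertex 0 of the cycle; if 3
   divides m, then {3j, 3j + 1} avoids the last vertex of the cycle instead. *)
Definition cokernel_degree d := (3 * d <= N)%N || (3 * d == N.+1) && (3 %| m)%N.

Lemma stable_halves k : kernel_degree k ->
  exists B, forall T, T \in stables e k.+1 -> (0 < #|T :&: B|)%N && (0 < #|T :\: B|)%N.
Proof.
(* The lower half has 2k vertices, or 2k + 1 when it contains the whole odd cycle. *)
move=> kk; pose b := if (N <= 4 * k)%N then (2 * k)%N else (2 * k).+1.
exists [set v | (b <= val v)%N] => T; rewrite inE => /andP[sT /eqP cT].
have nT : ~~ (#|T| <= k)%N by rewrite cT ltnn.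
(* If [T] lies in one half, it suffices to find k colours for which equal colours force consecutive
   vertices; this contradicts #|T| = k + 1. *)
have half (f : nat -> nat) : (forall v, v \in T -> (f v < k)%N) ->
    (forall u v, u \in T -> v \in T -> (u < v)%N -> f u = f v -> v = u.+1 :> nat) -> False.
  move=> fk fT; case/negP: nT; apply: stable_card_le sT fk _ => u v Tu Tv uv fuv.
  rewrite tadpoleE /tadpole_adj; have uv' : (u : nat) != v by [].
  by have := fT u v Tu Tv; have := fT v u Tv Tu; lia.
rewrite !card_gt0; apply/andP; split; apply/negP => /eqP/setP TB.
- have TB' v : v \in T -> (v < b)%N.
    by move=> Tv; move: (TB v); rewrite !inE Tv leqNgt => /negbFE.
  have [N4|N4] := leqP N (4 * k).
    apply: (half (fun v => v %/ 2)%N) => [v /TB'|u v _ _]; rewrite /b ?N4; lia.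
  have [kN mo mk] : [/\ N = (4 * k).+1, odd m & (m <= (2 * k).+1)%N].
    by move: kk; rewrite /kernel_degree leqNgt N4 /= => /and3P[/eqP].
  have bE : b = (2 * k).+1 by rewrite /b leqNgt N4.
  rewrite bE in TB'.
  have N0 : (0 < N)%N by lia.
  have mN : (m.-1 < N)%N by lia.
  (* The adjacent vertices 0 and m - 1 are not both in [T]. If m - 1 is missing, the pairs of
     consecutive vertices skip it; if 0 is missing, they start at 1. *)
  have [T0|T0] := boolP (Ordinal N0 \in T).
    have Tm : forall v, v \in T -> v != m.-1 :> nat.
      move=> v Tv; apply/eqP => vm; move/stableP: sT => /(_ _ _ T0 Tv).
      by rewrite tadpoleE /tadpole_adj /= vm !eqxx !orbT.
    apply: (half (fun v => if (v < m)%N then v %/ 2 else v.-1 %/ 2)%N) => [v Tv|u v Tu Tv].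
      by have := TB' v Tv; have := Tm v Tv; case: (ltnP v m); lia.
    by have := TB' v Tv; have := Tm v Tv; have := Tm u Tu; case: (ltnP v m); case: (ltnP u m); lia.
  have Tm : forall v, v \in T -> v != 0%N :> nat.
    move=> v Tv; apply: contraNneq T0 => v0; suff -> : Ordinal N0 = v by [].
    by apply: val_inj; rewrite /= v0.
  apply: (half (fun v => v.-1 %/ 2)%N) => [v Tv|u v Tu Tv].
    have := TB' v Tv; have := Tm v Tv; lia.
  have := TB' v Tv; have := Tm v Tv; have := TB' u Tu; have := Tm u Tu; lia.
- have TB' v : v \in T -> (b <= v)%N.
    by move=> Tv; move: (TB v); rewrite !inE Tv andbT => /negbFE.
  have Nb : (N <= b + 2 * k)%N.
    by move: kk; rewrite /b /kernel_degree; case: leqP => /=; lia.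
  apply: (half (fun v => (v - b) %/ 2)%N) => [v Tv|u v Tu Tv].
    have := TB' v Tv; have := ltn_ord v; lia.
  have := TB' v Tv; have := TB' u Tu; lia.
Qed.

Lemma no_weak_lefschetz k : kernel_degree k -> cokernel_degree k.+1 ->
  ~ weak_lefschetz (graph_algebra_part K (tadpole m n)).
Proof.
(* The pairs are {3j + r, 3j + r + 1} for j < d, with r = 1 if they all fit and r = 0 in the refined
   case where 3 divides m. *)
move=> kk dk; pose d := k.+1; pose r : nat := (3 * d <= N)%N.
have r1 : (r <= 1)%N by apply: leq_b1.
have rE : (3 * d + r <= N.+1)%N.
  rewrite /r; have [le|lt] := leqP (3 * d) N; first by rewrite addn1.
  by move: dk; rewrite /cokernel_degree -/d (leqNgt (3 * d)) lt addn0 /=; lia.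
have rm : r = 0%N -> (3 %| m)%N.
  by move: dk; rewrite /r /cokernel_degree -/d; case: (3 * d <= N)%N => //= /andP[].
clearbody r.
have lt0 (j : 'I_d) : (3 * j + r < N)%N by have := ltn_ord j; lia.
have lt1 (j : 'I_d) : ((3 * j + r).+1 < N)%N by have := ltn_ord j; lia.
pose p (j : 'I_d) := Ordinal (lt0 j); pose q (j : 'I_d) := Ordinal (lt1 j).
pose c (v : 'I_N) : 'I_N.+1 := inord (v %/ 3)%N.
have cE (v : 'I_N) : c v = (v %/ 3)%N :> nat by rewrite inordK //; have := ltn_ord v; lia.
pose s (v : 'I_N) : K :=
  if (v %/ 3 < d)%N then (v %% 3 == r)%N%:R - (v %% 3 == r.+1)%N%:R else 0.
have s0 v : s v != 0 -> (v %/ 3 < d)%N /\ (v %% 3 = r \/ v %% 3 = r.+1)%N.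
  rewrite /s; case: ifP => [lt|]; last by rewrite eqxx.
  case: (v %% 3 =P r)%N => ?; case: (v %% 3 =P r.+1)%N => ?; rewrite ?subrr ?eqxx // => _; split=> //; auto.
have p_inj : injective p by move=> i j /(congr1 val) /= E; apply: val_inj => /=; lia.
pose T0 := [set p j | j : 'I_d].
have cT0 : #|T0| = d by rewrite card_imset // card_ord.
have T0P v : v \in T0 -> (v %/ 3 < d)%N && (v %% 3 == r)%N.
  by move=> /imsetP[j _ ->] /=; have := ltn_ord j; lia.
have sT0 : stable e T0.
  apply/stableP => u v /T0P Tu /T0P Tv; rewrite tadpoleE /tadpole_adj.
  have := ltn_ord u; have := ltn_ord v; lia.
have T0d : T0 \in stables e d by rewrite inE sT0 cT0 eqxx.
have p0T : p ord0 \in T0 by apply: imset_f.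
have eI : irreflexive e by apply: adj_irr.
have ec u v : e u v -> s u * s v != 0 -> c u = c v.
  rewrite tadpoleE /tadpole_adj mulf_eq0 negb_or => uv /andP[/s0 su /s0 sv].
  apply/val_inj; rewrite /= !cE; move: uv su sv rm.
  have := ltn_ord u; have := ltn_ord v; lia.
have sc x : \sum_(v | c v == x) s v = 0.
  have [xd|xd] := ltnP x d; last first.
    rewrite big1 // => v /eqP cv; rewrite /s ifF //; apply/negbTE.
    by rewrite -leqNgt -cE cv.
  pose j := Ordinal xd; have xN := ltn_ord x.
  have cj : (c (p j) == x) && (c (q j) == x).
    by rewrite -!(inj_eq val_inj) /= !cE /=; lia.
  have [/eqP cp /eqP cq] := andP cj.
  rewrite (bigD1 (p j)) ?cp //= (bigD1 (q j)) /=; last first.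
    by rewrite cq eqxx -(inj_eq val_inj) /=; lia.
  rewrite big1 => [|v /andP[/andP[/eqP cv vp] vq]].
    have [dp mp dq mq] : [/\ ((3 * x + r) %/ 3 = x)%N, ((3 * x + r) %% 3 = r)%N,
        ((3 * x + r).+1 %/ 3 = x)%N & ((3 * x + r).+1 %% 3 = r.+1)%N] by split; lia.
    rewrite /s /= dp mp dq mq xd !eqxx (gtn_eqF (ltnSn r)) (ltn_eqF (ltnSn r)).
    by rewrite subr0 sub0r addr0 subrr.
  apply/eqP/negPn/negP => /s0[_ vr]; have := cE v; rewrite cv => xv.
  by move: vp vq; rewrite -!(inj_eq val_inj) /=; lia.
have [B hB] := stable_halves kk.
move=> /weak_lefschetzE[w /(_ k)[/(generic_weights _ _ _ _ K0).1|/(generic_weights _ _ _ _ K0).2]].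
- apply: (kernel_of_halves K0 hB); apply/set0Pn; exists (T0 :\ p ord0).
  exact: stablesS1.
- apply: (cokernel_of_pairs K0 eI ec sc) cT0 => [u v /imsetP[i _ ->] /imsetP[j _ ->]|v /imsetP[j _ ->]].
    move/(congr1 val); rewrite /= !cE /= => E; congr p; apply: val_inj => /=; lia.
  have [dp mp] : ((3 * j + r) %/ 3 = j)%N /\ ((3 * j + r) %% 3 = r)%N by split; lia.
  by rewrite /s /= dp mp ltn_ord eqxx (ltn_eqF (ltnSn r)) subr0 oner_eq0.
Qed.

End Tadpole.

(** * Certified sparse elimination *)

Definition row := seq (N * Z).

Section Elimination.
Variable cmp : N -> N -> comparison.

(** Computes a r + b s by a merge in the order [cmp] that drops cancelled entries; the inner [fix]
    recurses on the second list. *)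
Fixpoint comb_row (a b : Z) (r : row) : row -> row :=
  match r with
  | [::] => fun s => [seq (e.1, Z.mul b e.2) | e <- s]
  | (k, x) :: r' =>
    fix aux (s : row) : row :=
      match s with
      | [::] => [seq (e.1, Z.mul a e.2) | e <- r]
      | (l, y) :: s' =>
        match cmp k l with
        | Lt => (k, Z.mul a x) :: comb_row a b r' s
        | Gt => (l, Z.mul b y) :: aux s'
        | Eq => let z := Z.add (Z.mul a x) (Z.mul b y) in
                if Z.eqb z Z0 then comb_row a b r' s' else (k, z) :: comb_row a b r' s'
        end
      end
  end.

(** The map has positive keys, hence the shift by [N.succ_pos]; an empty row stands for a missing
    pivot. *)
Definition pivot (t : PositiveMap.t row) (k : N) : row :=
  if PositiveMap.find (N.succ_pos k) t is Some p then p else [::].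

(** Each step cancels the leading entry, with the gcd keeping coefficients small. A row that
    exhausts the fuel is dropped, which loses an equation but adds no false one. *)
Fixpoint insert_row (fuel : nat) (r : row) (t : PositiveMap.t row) :=
  if fuel is f.+1 then
    if r is (k, x) :: _ then
      let p := pivot t k in
      if p is (_, y) :: _ then
        let g := Z.gcd x y in
        insert_row f (comb_row (Z.div y g) (Z.opp (Z.div x g)) r p) t
      else PositiveMap.add (N.succ_pos k) r t
    else t
  else t.

Definition echelon (cols : seq N) (rs : seq row) : seq row :=
  let t := foldl (fun t r => insert_row (size cols) r t) (PositiveMap.empty row) rs in
  map (pivot t) cols.

Definition known (z : PositiveMap.t unit) (k : N) : bool :=
  if PositiveMap.find (N.succ_pos k) z is Some _ then true else false.

(* Back substitution: a row whose non-leading unknowns are all known to vanish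
   forces its leading unknown to vanish. *)
Definition zeros (ps : seq row) : PositiveMap.t unit :=
  foldr (fun p z => if p is (k, x) :: r then
      if ~~ Z.eqb x Z0 && all (fun e => known z e.1) r
      then PositiveMap.add (N.succ_pos k) tt z else z
    else z) (PositiveMap.empty unit) ps.

Definition full_rank (cols : seq N) (rs : seq row) : bool :=
  let z := zeros (echelon cols rs) in all (known z) cols.

Variables (K : fieldType) (K0 : [pchar K] =i pred0) (phi : N -> K).
Hypothesis cmpP : forall k l, cmp k l = Eq -> k = l.

Let zK (z : Z) : K := (int_of_Z z)%:~R.

Let zKD x y : zK (Z.add x y) = zK x + zK y.
Proof. by rewrite /zK -intrD; congr (_%:~R); apply: (rmorphD int_of_Z). Qed.

Let zKM x y : zK (Z.mul x y) = zK x * zK y.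
Proof. by rewrite /zK -intrM; congr (_%:~R); apply: (rmorphM int_of_Z). Qed.

Let zK_eq0 x : zK x = 0 -> Z.eqb x Z0.
Proof.
have natK := (pcharf0P K).1 K0.
have intK z : (z%:~R == 0 :> K) = (z == 0).
  by case: z => k; rewrite ?NegzE ?mulrNz ?oppr_eq0 -pmulrn natK.
move/eqP; rewrite /zK intK => /eqP E; apply/Z.eqb_eq.
by rewrite -[x]int_of_ZK E.
Qed.

(** A row is a homogeneous linear equation in the unknowns [phi k], and this is its left-hand
    side. *)
Definition row_sum (r : row) : K := \sum_(e <- r) zK e.2 * phi e.1.

Lemma row_sum_scale a r : row_sum [seq (e.1, Z.mul a e.2) | e <- r] = zK a * row_sum r.
Proof.
rewrite /row_sum big_map mulr_sumr; apply: eq_bigr => e _ /=.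
by rewrite zKM mulrA.
Qed.

Lemma row_sum_cons k x r : row_sum ((k, x) :: r) = zK x * phi k + row_sum r.
Proof. exact: big_cons. Qed.

Lemma row_sum_comb a b r s :
  row_sum (comb_row a b r s) = zK a * row_sum r + zK b * row_sum s.
Proof.
elim: r s => [|[k x] r IHr] s; first by rewrite row_sum_scale /row_sum big_nil mulr0 add0r.
elim: s => [|[l y] s IHs].
  by rewrite [LHS]row_sum_scale [row_sum [::]]big_nil mulr0 addr0.
rewrite [comb_row _ _ _ _]/=; case E: (cmp k l).
- have {E} <- := cmpP E; have IH := IHr s.
  case: ifP => [/Z.eqb_eq z0|_]; rewrite !row_sum_cons IH; last first.
    by rewrite zKD !zKM; ring.
  have {}z0 : zK a * zK x + zK b * zK y = 0 by rewrite -!zKM -zKD z0.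
  transitivity ((zK a * zK x + zK b * zK y) * phi k + (zK a * row_sum r + zK b * row_sum s)).
    by rewrite z0 mul0r add0r.
  ring.
- by rewrite row_sum_cons IHr !row_sum_cons zKM; ring.
- rewrite row_sum_cons [X in _ + X]IHs !row_sum_cons zKM; ring.
Qed.

Arguments comb_row : simpl never.

Lemma pivot_add t k l r :
  pivot (PositiveMap.add (N.succ_pos k) r t) l = if k == l then r else pivot t l.
Proof.
rewrite /pivot; case: eqP => [->|kl]; first by rewrite PositiveMap.gss.
by rewrite PositiveMap.gso // => E; apply: kl; lia.
Qed.

Lemma insert_row_sound fuel r t :
  row_sum r = 0 -> (forall k, row_sum (pivot t k) = 0) ->
  forall k, row_sum (pivot (insert_row fuel r t) k) = 0.
Proof.
elim: fuel r t => //= f IH [|[k x] r] t //= r0 t0 l.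
case Ep: (pivot t k) => [|[i y] p].
  by rewrite pivot_add; case: eqP.
by apply: IH => //; rewrite row_sum_comb r0 -Ep t0 !mulr0 addr0.
Qed.

Lemma echelon_sound cols rs : (forall r, r \in rs -> row_sum r = 0) ->
  forall p, p \in echelon cols rs -> row_sum p = 0.
Proof.
move=> rs0 _ /mapP[k _ ->]; set t := PositiveMap.empty row.
have: forall k, row_sum (pivot t k) = 0.
  by move=> l; rewrite /pivot PositiveMap.gempty /row_sum big_nil.
elim: rs t rs0 => //= r rs IH t rs0 t0; apply: IH.
  by move=> s srs; apply: rs0; rewrite inE srs orbT.
by apply: insert_row_sound => //; apply: rs0; rewrite inE eqxx.
Qed.

Lemma zeros_sound ps : (forall p, p \in ps -> row_sum p = 0) ->
  forall k, known (zeros ps) k -> phi k = 0.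
Proof.
elim: ps => [|p ps IH] ps0 k; first by rewrite /known PositiveMap.gempty.
have {}IH : forall k, known (zeros ps) k -> phi k = 0.
  by apply: IH => q qps; apply: ps0; rewrite inE qps orbT.
have := ps0 p (mem_head _ _); rewrite /=; case: p {ps0} => [|[l x] r]; first by move=> _ /IH.
rewrite row_sum_cons; case: ifP => [/andP[x0 /allP rz]|_ _ /IH//].
rewrite [row_sum r]big_seq big1 => [|e /rz/IH ->]; last by rewrite mulr0.
rewrite addr0 => /eqP; rewrite mulf_eq0 => /orP[/eqP/zK_eq0|/eqP l0].
  by rewrite (negPf x0).
rewrite /known; have [->//|kl] := eqVneq k l.
by rewrite PositiveMap.gso; [apply: IH|move=> E; case/eqP: kl; lia].
Qed.

(** Rows combined from equations that [phi] satisfies are again satisfied by [phi], so back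
    substitution draws true conclusions about it. *)
Lemma full_rank_sound cols rs : full_rank cols rs ->
  (forall r, r \in rs -> row_sum r = 0) -> forall k, k \in cols -> phi k = 0.
Proof. by move=> /allP fr rs0 k /fr; apply: zeros_sound; apply: echelon_sound. Qed.

Lemma row_sum_ones (ks : seq N) : row_sum [seq (k, Zpos xH) | k <- ks] = \sum_(k <- ks) phi k.
Proof. by rewrite /row_sum big_map; apply: eq_bigr => k _; rewrite mul1r. Qed.

End Elimination.

(** * Independent sets as binary codes *)

Section Codes.
Variables (n : nat) (nb : seq N).

(* A subset of {0, ..., n - 1} is encoded by the binary number with the
   corresponding bits set. *)
Definition mem_code (x : N) (v : nat) := N.testbit x (N.of_nat v).

Definition free_code (x : N) (v : nat) := N.eqb (N.land x (nth N0 nb v)) N0.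

Fixpoint stable_codes (v k : nat) : seq N :=
  match k, v with
  | 0%N, _ => [:: N0]
  | _, 0%N => [::]
  | k'.+1, v'.+1 => stable_codes v' k ++
      [seq N.setbit x (N.of_nat v') | x <- stable_codes v' k' & free_code x v']
  end.

(** For a code of [T], the equation that the coefficient of x_T places on a kernel element, whose
    values on [T] minus a vertex sum to 0. *)
Definition down_row (x : N) : row :=
  [seq (y, Zpos xH) | y <-
    [seq N.clearbit x (N.of_nat v) | v <- rev (iota 0 n) & mem_code x v]].

(** The transposed equation, over the stable sets that extend the given one by a vertex. *)
Definition up_row (x : N) : row :=
  [seq (y, Zpos xH) | y <-
    [seq N.setbit x (N.of_nat v) | v <- rev (iota 0 n) & ~~ mem_code x v && free_code x v]].

(* The orders of rows and columns are chosen to keep the fill-in small. *)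
Definition injective_in_degree (i : nat) : bool :=
  full_rank N.compare (stable_codes n i) [seq down_row x | x <- rev (stable_codes n i.+1)].

Definition surjective_in_degree (i : nat) : bool :=
  full_rank (fun k l => N.compare l k)
    (rev (stable_codes n i.+1)) [seq up_row x | x <- stable_codes n i].

End Codes.

Definition neighbour_codes (n : nat) (a : rel nat) : seq N :=
  [seq foldr (fun u x => if a u v then N.setbit x (N.of_nat u) else x) N0 (iota 0 n)
  | v <- iota 0 n].

(** * Correctness of the codes and of the rank checks *)

Section CodesSound.
Variables (n : nat) (a : rel nat) (e : rel 'I_n).
Hypotheses (eE : forall u v, e u v = a u v) (eS : symmetric e) (eI : irreflexive e).

Definition decode (x : N) : {set 'I_n} := [set v : 'I_n | mem_code x v].

Lemma decode0 : decode N0 = set0.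
Proof. by apply/setP => u; rewrite !inE /mem_code N.bits_0. Qed.

Lemma decode_set x (v : 'I_n) : decode (N.setbit x (N.of_nat v)) = v |: decode x.
Proof.
apply/setP => u; rewrite !inE /mem_code N.setbit_eqb -(inj_eq val_inj) eq_sym /=.
by congr (_ || _); lia.
Qed.

Lemma decode_clear x (v : 'I_n) : decode (N.clearbit x (N.of_nat v)) = decode x :\ v.
Proof.
apply/setP => u; rewrite !inE /mem_code N.clearbit_eqb -(inj_eq val_inj) eq_sym /= andbC.
by congr (~~ _ && _); lia.
Qed.

Local Notation nb := (neighbour_codes n a).

Lemma free_codeE x (v : 'I_n) : free_code nb x v = [forall u in decode x, ~~ e u v].
Proof.
have nbE (u : nat) : mem_code (nth N0 nb v) u = (u < n)%N && a u v.
  rewrite (nth_map 0%N) ?size_iota // nth_iota // add0n.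
  have -> : (u < n)%N = (u \in iota 0 n) by rewrite mem_iota.
  elim: (iota 0 n) => [|w s IH] //=.
  rewrite inE; case: ifP => aw; last first.
    by rewrite IH; case: (u =P w) => [->|//]; rewrite aw !andbF.
  rewrite /mem_code N.setbit_eqb -/(mem_code _ _) IH.
  have -> : N.eqb (N.of_nat w) (N.of_nat u) = (u == w) by lia.
  by case: (u =P w) => [->|//]; rewrite aw.
apply/idP/forall_inP => [/N.eqb_eq x0 u|H].
  rewrite inE eE => xu; apply/negP => auv.
  have := N.bits_0 (N.of_nat u); rewrite -x0 N.land_spec -!/(mem_code _ _).
  by rewrite xu nbE ltn_ord auv.
apply/N.eqb_eq; apply: N.bits_inj => k; rewrite N.land_spec N.bits_0 -[k]Nnat.N2Nat.id.
rewrite -!/(mem_code _ _) nbE; apply/negbTE/and3P => -[xk kn ak].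
by have := H (Ordinal kn); rewrite inE eE /= xk ak => /(_ isT).
Qed.

Lemma stableU1 (S : {set 'I_n}) v :
  stable e (v |: S) = stable e S && [forall u in S, ~~ e u v].
Proof.
apply/idP/andP => [sS|[/stableP sS /forall_inP vS]].
  split; first exact: stableS (subsetUr _ _) sS.
  by apply/forall_inP => u Su; move/stableP: sS; apply; rewrite !inE ?Su ?eqxx ?orbT.
apply/stableP => u w; rewrite !inE.
move=> /orP[/eqP ->|Su] /orP[/eqP ->|Sw]; [by rewrite eI | | exact: vS | exact: sS].
by rewrite eS vS.
Qed.

Lemma stable_codes_sound v k x : (v <= n)%N -> x \in stable_codes nb v k ->
  decode x \in stables e k /\ {in decode x, forall u : 'I_n, (u < v)%N}.
Proof.
elim: v k x => [|v IH] [|k] x le_vn //=.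
- rewrite inE => /eqP ->; rewrite decode0; split=> [|u]; last by rewrite inE.
  by rewrite inE cards0 eqxx andbT; apply/stableP => u; rewrite inE.
- rewrite inE => /eqP ->; rewrite decode0; split=> [|u]; last by rewrite inE.
  by rewrite inE cards0 eqxx andbT; apply/stableP => u; rewrite inE.
rewrite mem_cat => /orP[/(IH _ _ (ltnW le_vn))[sx xv]|/mapP[y]].
  by split=> // u ux; apply/leqW/xv.
rewrite mem_filter => /andP[fy /(IH _ _ (ltnW le_vn))[sy yv] ->].
rewrite (decode_set y (Ordinal le_vn)); split=> [|u].
  move: sy; rewrite !inE stableU1 -free_codeE fy andbT => /andP[-> /eqP cy].
  have yw : Ordinal le_vn \notin decode y by apply/negP => /yv /=; rewrite ltnn.
  by rewrite cardsU1 cy yw add1n eqxx.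
by rewrite !inE => /orP[/eqP -> /=|]; [|move=> uy; apply/leqW/yv; rewrite inE].
Qed.

Lemma stable_codes_complete v k S : (v <= n)%N -> S \in stables e k ->
  {in S, forall u : 'I_n, (u < v)%N} -> exists2 x, x \in stable_codes nb v k & decode x = S.
Proof.
elim: v k S => [|v IH] [|k] S le_vn; rewrite inE => /andP[sS /eqP cS] Sv.
- exists N0; rewrite ?inE //; by rewrite (cards0_eq cS) decode0.
- have /card_gt0P[u Su] : (0 < #|S|)%N by rewrite cS.
  by have := Sv u Su.
- exists N0; rewrite ?inE //; by rewrite (cards0_eq cS) decode0.
pose w := Ordinal le_vn; have [Sw|Sw] := boolP (w \in S); last first.
  have [||x xv <-] := IH k.+1 S (ltnW le_vn); rewrite ?inE ?sS ?cS ?eqxx //.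
    move=> u Su; have := Sv u Su; rewrite ltnS leq_eqVlt => /orP[/eqP uv|//].
    by case/negP: Sw; rewrite -(_ : u = w) //; apply: val_inj.
  by exists x => //=; rewrite mem_cat xv.
have [||x xv xS] := IH k (S :\ w) (ltnW le_vn).
- by apply: stablesS1 => //; rewrite inE sS cS eqxx.
- move=> u /setD1P[uw Su]; have := Sv u Su; rewrite ltnS leq_eqVlt => /orP[/eqP uv|//].
  by case/eqP: uw; apply: val_inj.
exists (N.setbit x (N.of_nat w)); last by rewrite decode_set xS setD1K.
rewrite /= mem_cat; apply/orP; right; apply/mapP; exists x => //.
rewrite mem_filter xv andbT (free_codeE x w).
by move: sS; rewrite -{1}(setD1K Sw) stableU1 -xS => /andP[].
Qed.

Variables (K : fieldType) (K0 : [pchar K] =i pred0).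

(** A kernel element composed with [decode] satisfies all equations of the check, and every stable
    set has a code. *)
Lemma injective_in_degree_sound i : injective_in_degree n nb i ->
  rows_free (stables e i) (stables e i.+1) (incidence (fun=> 1 : K)).
Proof.
move=> fr f f0 S iS.
have [|x xi <-] := @stable_codes_complete n i S (leqnn n) iS; first by move=> u; rewrite ltn_ord.
apply: (full_rank_sound K0 (phi := f \o decode) _ fr) xi => [k l /N.compare_eq//|r].
move=> /mapP[y]; rewrite mem_rev => /(stable_codes_sound (leqnn n))[iy _] ->.
rewrite row_sum_ones big_map big_filter (perm_big (iota 0 n)) ?perm_rev //=.
have -> : iota 0 n = index_iota 0 n by rewrite /index_iota subn0.
rewrite big_mkord -[RHS](f0 _ iy) sum_incidence //.
under [RHS]eq_bigr do rewrite mul1r.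
by apply: eq_big => [v|v _] /=; rewrite ?inE // decode_clear.
Qed.

Lemma surjective_in_degree_sound i : surjective_in_degree n nb i ->
  rows_free (stables e i.+1) (stables e i) (fun T S => incidence (fun=> 1 : K) S T).
Proof.
move=> fr g g0 T iT.
have [|x xi <-] := @stable_codes_complete n i.+1 T (leqnn n) iT; first by move=> u; rewrite ltn_ord.
have {}xi : x \in rev (stable_codes nb n i.+1) by rewrite mem_rev.
apply: (full_rank_sound K0 (phi := g \o decode) _ fr) xi => [k l /N.compare_eq//|r].
move=> /mapP[y /(stable_codes_sound (leqnn n))[iy _] ->].
rewrite row_sum_ones big_map big_filter (perm_big (iota 0 n)) ?perm_rev //=.
have -> : iota 0 n = index_iota 0 n by rewrite /index_iota subn0.
rewrite big_mkord -[RHS](g0 _ iy) sum_incidence_tr //.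
under [RHS]eq_bigr do rewrite mul1r.
apply: eq_big => [v|v _] /=; last by rewrite decode_set.
by move: iy; rewrite !inE stableU1 free_codeE => /andP[-> _].
Qed.

(** Surjectivity propagates upwards because the algebra is generated in degree 1. Dually,
    contracting an element [g] of the transposed kernel by x_u, with u in [T], gives an element [h]
    of the transposed kernel one degree lower; it vanishes, and so does its value [g T] at
    [T :\ u]. *)
Lemma surjective_next i :
  rows_free (stables e i.+1) (stables e i) (fun T S => incidence (fun=> 1 : K) S T) ->
  rows_free (stables e i.+2) (stables e i.+1) (fun T S => incidence (fun=> 1 : K) S T).
Proof.
move=> fr g g0 T iT; have /card_gt0P[u Tu] : (0 < #|T|)%N.
  by move: iT; rewrite inE => /andP[_ /eqP ->].
pose h (S : {set 'I_n}) := if (u \notin S) && stable e (u |: S) then g (u |: S) else 0.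
have: h (T :\ u) = 0; last first.
  by move: iT; rewrite /h setD11 setD1K // inE => /andP[-> _].
apply: fr (stablesS1 iT Tu) => R iR; rewrite sum_incidence_tr //.
(* If [R] contains [u] or [u |: R] is not stable, all values of [h] that occur are 0. Otherwise the
   equation of [h] at [R] is that of [g] at [u |: R]. *)
have [Ru|Ru] := boolP (u \in R).
  by rewrite big1 // => v _; rewrite /h inE Ru orbT mulr0.
have [suR|suR] := boolP (stable e (u |: R)); last first.
  rewrite big1 // => v _; rewrite /h ifF ?mulr0 //; apply: contraNF suR => /andP[_].
  by apply: stableS; rewrite setUS // subsetUr.
have iuR : u |: R \in stables e i.+1.
  by move: iR; rewrite !inE suR cardsU1 Ru => /andP[_ /eqP ->]; rewrite add1n eqxx.
rewrite -[RHS](g0 _ iuR) sum_incidence_tr // big_mkcond [RHS]big_mkcond.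
apply: eq_bigr => v _; rewrite /h !inE negb_or setUCA.
have [->|vu] := eqVneq v u; first by rewrite /= mulr0 if_same.
rewrite Ru /=; case: (v \in R) => //=.
have [sv|sv] := boolP (stable e (v |: R)).
  by case: (stable e _); rewrite ?mulr0.
rewrite ifF //; apply: contraNF sv; apply: stableS.
by rewrite setUS // subsetUr.
Qed.

End CodesSound.

Local Close Scope ring_scope.

(** * The classification *)

(* The third component is the least degree i with h_i >= h_(i+1) for the Hilbert
   function h of the algebra. *)
Definition lefschetz_cases : seq (nat * nat * nat) :=
  [:: (3, 1, 1); (3, 3, 2); (3, 4, 2); (3, 7, 3); (4, 1, 1); (4, 2, 2);
      (4, 3, 2); (4, 4, 2); (4, 5, 3); (4, 6, 3); (4, 7, 3); (4, 9, 4);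
      (4, 10, 4); (4, 13, 5); (5, 1, 2); (5, 2, 2); (5, 3, 2); (5, 5, 3);
      (5, 6, 3); (5, 9, 4); (6, 1, 2); (6, 3, 3); (6, 4, 3); (6, 7, 4);
      (7, 1, 2); (7, 2, 3); (7, 3, 3); (7, 4, 3); (7, 7, 4); (8, 1, 3);
      (8, 2, 3); (8, 3, 3); (8, 5, 4); (8, 6, 4); (8, 9, 5); (9, 1, 3);
      (9, 4, 4); (10, 1, 3); (10, 3, 4); (10, 4, 4); (10, 7, 5); (11, 2, 4);
      (11, 3, 4); (11, 6, 5); (12, 1, 4); (13, 1, 4); (13, 4, 5); (14, 3, 5);
      (16, 1, 5)].

Definition full_rank_case (c : nat * nat * nat) : bool :=
  let: (m, n, i0) := c in
  let nb := neighbour_codes (m + n) (tadpole_adj m) in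
  all (injective_in_degree (m + n) nb) (iota 0 i0) &&
  surjective_in_degree (m + n) nb i0.

Lemma full_rank_cases : all full_rank_case lefschetz_cases.
Proof. vm_cast_no_check (erefl true). Qed.

(** The computation covers injectivity below [i0] and surjectivity at [i0]; [surjective_next]
    supplies the higher degrees. *)
Lemma weak_lefschetz_of_case (K : fieldType) (K0 : [pchar K]%R =i pred0) (m n i0 : nat) :
  2 < m -> 0 < n -> full_rank_case (m, n, i0) ->
  weak_lefschetz (graph_algebra_part K (tadpole m n)).
Proof.
move=> m3 n1 /andP[/allP inj sur]; apply/weak_lefschetzE; exists (fun=> 1%R) => i.
have eE := @tadpoleE m n m3 n1.
have eS := adj_sym (tadpole m n); have eI := adj_irr (tadpole m n).
have [lt|le] := ltnP i i0.
  by left; apply: (injective_in_degree_sound eE eS eI K0); apply: inj; rewrite mem_iota.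
right; rewrite -(subnK le); elim: (i - i0) => [|j IH].
  exact: (surjective_in_degree_sound eE eS eI K0).
by rewrite addSn; apply: surjective_next.
Qed.

Theorem theorem1p2 (K : fieldType) (hK : [pchar K]%R =i pred0)
    (m n : nat) (hm : 3 <= m) (hn : 1 <= n) :
  weak_lefschetz (graph_algebra_part K (tadpole m n)) <->
  (m \in [:: 3; 6; 10] /\ n \in [:: 1; 3; 4; 7]) \/
  (m = 4 /\ n \in [:: 1; 2; 3; 4; 5; 6; 7; 9; 10; 13]) \/
  (m \in [:: 5; 8] /\ n \in [:: 1; 2; 3; 5; 6; 9]) \/
  (m = 7 /\ n \in [:: 1; 2; 3; 4; 7]) \/
  (m, n) \in [:: (9, 1); (9, 4); (11, 2); (11, 3); (11, 6);
                 (12, 1); (13, 1); (13, 4); (14, 3); (16, 1)].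
Proof.
pose cases := [seq c.1 | c <- lefschetz_cases].
split=> [wl|good]; last first.
  have : (m, n) \in cases.
    have prod (s t : seq nat) : all (fun i => all (fun j => (i, j) \in cases) t) s ->
        m \in s -> n \in t -> (m, n) \in cases.
      by move=> /allP st /st /allP; apply.
    case: good => [[ms nt]|[[m4 nt]|[[ms nt]|[[m7 nt]|mn]]]].
    - exact: prod ms nt.
    - by apply: (prod [:: 4] _ _ _ nt); rewrite // m4.
    - exact: prod ms nt.
    - by apply: (prod [:: 7] _ _ _ nt); rewrite // m7.
    - by apply/(allP (_ : all (mem cases) _)): mn.
  move=> /mapP[[[m' n'] i0] ci [mE nE]]; rewrite -mE -nE in ci.
  exact: weak_lefschetz_of_case hK _ _ _ hm hn (allP full_rank_cases _ ci).
have degrees : has (fun k => kernel_degree m n k && cokernel_degree m n k.+1) (iota 0 (m + n)) \/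
    (m, n) \in cases.
  have [N18|N18] := leqP 18 (m + n).
    (* The witness is N / 4 rounded up, the least k with N <= 4k; from N = 18 on it also satisfies
       3(k + 1) <= N. *)
    left; apply/hasP; exists ((m + n + 3) %/ 4); first by rewrite mem_iota; lia.
    by rewrite /kernel_degree /cokernel_degree; lia.
  apply/orP; move: N18.
  (* As m >= 3 and n >= 1, these ranges contain all pairs with m + n < 18: each has an obstructed
     degree or is in the list. *)
  have : all (fun i => all (fun j => (i + j < 18) ==>
      has (fun k => kernel_degree i j k && cokernel_degree i j k.+1) (iota 0 (i + j)) ||
      ((i, j) \in cases)) (iota 1 15)) (iota 3 15) by vm_compute.
  move=> /allP/(_ m) H N18; move: H; rewrite mem_iota => /(_ _)/allP/(_ n).
  by rewrite mem_iota N18 /=; apply; lia.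
case: degrees => [/hasP[k _ /andP[kk dk]]|mn].
  by case: (no_weak_lefschetz hm hn hK kk dk wl).
have : all (fun p : nat * nat => [|| (p.1 \in [:: 3; 6; 10]) && (p.2 \in [:: 1; 3; 4; 7]),
    (p.1 == 4) && (p.2 \in [:: 1; 2; 3; 4; 5; 6; 7; 9; 10; 13]),
    (p.1 \in [:: 5; 8]) && (p.2 \in [:: 1; 2; 3; 5; 6; 9]),
    (p.1 == 7) && (p.2 \in [:: 1; 2; 3; 4; 7]) |
    p \in [:: (9, 1); (9, 4); (11, 2); (11, 3); (11, 6);
              (12, 1); (13, 1); (13, 4); (14, 3); (16, 1)]]) cases by vm_compute.
move=> /allP/(_ _ mn) /=.
by case/or4P => [/andP[? ?]|/andP[/eqP ? ?]|/andP[? ?]|/orP[/andP[/eqP ? ?]|?]]; tauto.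
Qed.
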